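(* Let $X$ and $Y$ be complex topological vector spaces, and let $\Gamma\subset\mathcal{B}(X)$ and $\Gamma_1\subset\mathcal{B}(Y)$ be quasi-similar via a continuous linear operator $\phi:X\to Y$ with dense range. If $\Gamma$ is diskcyclic in $X$, then $\Gamma_1$ is diskcyclic in $Y$. Moreover, $\phi(\mathbb{D}C(\Gamma))\subset\mathbb{D}C(\Gamma_1)$.
   Context: $\mathcal{B}(X)$ is the set of all continuous linear operators on $X$, and $\mathbb{D}=\{\alpha\in\mathbb{C}:|\alpha|\le 1\}$. $\Gamma$ and $\Gamma_1$ are called quasi-similar if there exists a continuous linear operator $\phi:X\to Y$ with dense range such that for all $T\in\Gamma$ there exists $S\in\Gamma_1$ satisfying $S\circ\phi=\phi\circ T$. A vector $x\in X$ is a diskcyclic vector for $\Gamma$ if $\{\alpha Tx:\alpha\in\mathbb{D},\,T\in\Gamma\}$ is dense in $X$; $\mathbb{D}C(\Gamma)$ is the set of all diskcyclic vectors for $\Gamma$, and $\Gamma$ is diskcyclic if $\mathbb{D}C(\Gamma)\neq\emptyset$ (similarly for $\Gamma_1$ on $Y$). *)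

(* Defs.v *)
From mathcomp Require Import all_boot all_order all_algebra.
From mathcomp Require Import all_classical all_reals all_analysis.
From mathcomp Require Import complex.

Set Implicit Arguments.
Unset Strict Implicit.
Unset Printing Implicit Defensive.

Import Order.TTheory GRing.Theory Num.Theory.
Import numFieldNormedType.Exports.

Local Open Scope classical_set_scope.
Local Open Scope ring_scope.
Local Open Scope complex_scope.

(* The complex numbers are R[i] over an abstract realType R; complex
   topological vector spaces are topologicalLmodType R[i], with neither local
   convexity nor the Hausdorff property assumed. *)

Definition continuous_operators (R : realType)
    (X Y : topologicalLmodType R[i]) : set {linear X -> Y} :=
  [set f | continuous f].

Arguments continuous_operators {R} X Y.

Definition unit_disk (R : realType) : set R[i] := [set a | `|a| <= 1].

Definition disk_orbit (R : realType) (X : topologicalLmodType R[i])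
    (G : set {linear X -> X}) (x : X) : set X :=
  [set y | exists a T, [/\ unit_disk a, G T & y = a *: T x]].

Definition diskcyclic_vectors (R : realType) (X : topologicalLmodType R[i])
    (G : set {linear X -> X}) : set X :=
  [set x | dense (disk_orbit G x)].

Definition diskcyclic (R : realType) (X : topologicalLmodType R[i])
    (G : set {linear X -> X}) : Prop :=
  diskcyclic_vectors G !=set0.

(* This relation is not symmetric in G and G1. *)
Definition quasi_similar_via (R : realType) (X Y : topologicalLmodType R[i])
    (phi : {linear X -> Y})
    (G : set {linear X -> X}) (G1 : set {linear Y -> Y}) : Prop :=
  [/\ continuous_operators X Y phi, dense (range phi)
    & forall T, G T -> exists2 S, G1 S & S \o phi = phi \o T :> (X -> Y)].

(* Main.v *)
Require Import Defs.
From mathcomp Require Import all_boot all_order all_algebra.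
From mathcomp Require Import all_classical all_reals all_analysis.
From mathcomp Require Import complex.

Import Order.TTheory GRing.Theory Num.Theory.
Import numFieldNormedType.Exports.

Local Open Scope classical_set_scope.
Local Open Scope ring_scope.
Local Open Scope complex_scope.

(** A continuous map with dense range sends dense sets to dense sets ([dense_image]). If [S]
    intertwines with [T] through [phi], then [phi (a *: T x) = a *: S (phi x)], so [phi] carries the
    disk orbit of [x] into that of [phi x] ([image_disk_orbit]). The orbit of [phi x] thus contains
    the image of a dense set whenever [x] is diskcyclic. *)

Lemma dense_image {T U : topologicalType} {f : T -> U} {A : set T} {B : set U} :
  continuous f -> dense (range f) -> dense A -> f @` A `<=` B -> dense B.
Proof.
move=> /continuousP fcont frange Adense AB O O0 Oopen.
(* A point of the range in [O] makes the open preimage of [O] nonempty, so the density of [A]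
   applies to it. *)
have [y [Oy [x _ xE]]] := frange O O0 Oopen.
have [|z [Ofz Az]] := Adense (f @^-1` O) _ (fcont _ Oopen).
  by exists x; rewrite /preimage /= xE.
by exists (f z); split=> //; apply: AB; exists z.
Qed.

(** The scalar is kept, so it stays in the disk. Only an inclusion is claimed: [G1] may contain
    operators matched with no [T] in [G]. *)
Lemma image_disk_orbit {R : realType} {X Y : topologicalLmodType R[i]}
    {G : set {linear X -> X}} {G1 : set {linear Y -> Y}}
    {phi : {linear X -> Y}} (x : X) :
  quasi_similar_via phi G G1 ->
  phi @` disk_orbit G x `<=` disk_orbit G1 (phi x).
Proof.
move=> [_ _ intertwine] _ [_ [a [T [a1 GT ->]]] <-].
have [S G1S Sphi] := intertwine T GT.
exists a, S; split=> //.
(* The intertwining relation is an equality of functions, here evaluated at [x]. *)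
by rewrite linearZ; congr (_ *: _); have := congr1 (@^~ x) Sphi.
Qed.

Theorem proposition2p7 (R : realType) (X Y : topologicalLmodType R[i])
    (G : set {linear X -> X}) (G1 : set {linear Y -> Y})
    (phi : {linear X -> Y})
    (G_sub : G `<=` continuous_operators X X)
    (G1_sub : G1 `<=` continuous_operators Y Y)
    (G_qsim_G1 : quasi_similar_via phi G G1) :
  (diskcyclic G -> diskcyclic G1) /\
  phi @` diskcyclic_vectors G `<=` diskcyclic_vectors G1.
Proof.
have sub : phi @` diskcyclic_vectors G `<=` diskcyclic_vectors G1.
  move=> _ [x xcyc <-]; have [phi_cont phi_dense _] := G_qsim_G1.
  exact: dense_image phi_cont phi_dense xcyc (image_disk_orbit x G_qsim_G1).
by split=> // -[x xcyc]; exists (phi x); apply: sub; exists x.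
Qed.
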